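(* Let $(X,f_{1,\infty})$ be a nonautonomous dynamical system, and let $K$ be a nonempty $f_{1,\infty}$-invariant subset of $X$. Then for any $1\le i\le j<\infty$, $$D(f_{i,\infty},K)\le D(f_{j,\infty},K).$$
   Context: A nonautonomous dynamical system $(X,f_{1,\infty})$ consists of a compact topological space $X$ and a sequence $f_{1,\infty}=(f_i)_{i\ge 1}$ of continuous maps $f_i:X\to X$. For $i\ge1$, $f_{i,\infty}$ denotes the shifted sequence $(f_i,f_{i+1},f_{i+2},\dots)$. A subset $K\subseteq X$ is $f_{1,\infty}$-invariant if $f_i^{-1}(K)=K$ for all $i\ge 1$. Pesin topological entropy dimension of a sequence $g_{1,\infty}=(g_i)_{i\ge1}$ of continuous selfmaps of $X$ on nonempty $K\subseteq X$ (applied above to $g_{1,\infty}=f_{i,\infty}$ and $f_{j,\infty}$). Put $g_1^0=\mathrm{id}_X$, $g_1^j=g_j\circ\cdots\circ g_1$. For a finite open cover $\mathcal{U}$ of $X$, let $S(\mathcal{U})$ be the set of all finite strings $\mathbf{U}=(U_{i_0},\dots,U_{i_{m-1}})$ of elements of $\mathcal{U}$, with length $m(\mathbf{U})=m$, and let $X(\mathbf{U})=\{x\in X: g_1^j(x)\in U_{i_j},\ 0\le j\le m(\mathbf{U})-1\}$. A collection $\mathcal{G}\subseteq S(\mathcal{U})$ covers $K$ if $K\subseteq\bigcup_{\mathbf{U}\in\mathcal{G}}X(\mathbf{U})$. For $\alpha\in\mathbb{R}$, $s>0$ let $M(g_{1,\infty},K,s,\mathcal{U},\alpha,N)=\inf_{\mathcal{G}}\sum_{\mathbf{U}\in\mathcal{G}}e^{-\alpha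 m(\mathbf{U})^s}$, the infimum over all finite or countable $\mathcal{G}\subseteq S(\mathcal{U})$ covering $K$ with $m(\mathbf{U})\ge N$ for all $\mathbf{U}\in\mathcal{G}$. Let $m(g_{1,\infty},K,s,\mathcal{U},\alpha)=\lim_{N\to\infty}M(g_{1,\infty},K,s,\mathcal{U},\alpha,N)$, $D(g_{1,\infty},K,s,\mathcal{U})=\inf\{\alpha: m(g_{1,\infty},K,s,\mathcal{U},\alpha)=0\}=\sup\{\alpha: m(g_{1,\infty},K,s,\mathcal{U},\alpha)=\infty\}$, and $D(g_{1,\infty},K,s)=\sup_{\mathcal{U}}D(g_{1,\infty},K,s,\mathcal{U})$ over finite open covers $\mathcal{U}$ of $X$. Then $D(g_{1,\infty},K)=\sup\{s>0:D(g_{1,\infty},K,s)=+\infty\}=\inf\{s>0:D(g_{1,\infty},K,s)=0\}$, with $\inf\emptyset=+\infty$ and $\sup\emptyset=0$ for sets of $s>0$. *)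

(* Defs.v *)
From mathcomp Require Import all_boot all_order all_algebra.
From mathcomp Require Import all_classical all_reals all_analysis.
From mathcomp Require Import lra.

Set Implicit Arguments.
Unset Strict Implicit.
Unset Printing Implicit Defensive.

Import Order.TTheory GRing.Theory Num.Theory.
Import numFieldNormedType.Exports.

Local Open Scope classical_set_scope.
Local Open Scope ring_scope.
Local Open Scope ereal_scope.

(* A sequence of maps (f_i)_(i >= 1) is represented by f : nat -> X -> X;
   the value f 0 is never used. *)

Definition nds (X : topologicalType) (f : nat -> X -> X) : Prop :=
  compact [set: X] /\ forall i, (1 <= i)%N -> continuous (f i).

(* (f_i, f_{i+1}, ...), again indexed from 1 *)
Definition shifted (X : Type) (f : nat -> X -> X) (i : nat) : nat -> X -> X :=
  fun k => f (i + k).-1.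

Definition nds_invariant (X : Type) (f : nat -> X -> X) (K : set X) : Prop :=
  forall i, (1 <= i)%N -> f i @^-1` K = K.

(* g_1^j = g_j \o ... \o g_1 *)
Fixpoint orbit_map (X : Type) (g : nat -> X -> X) (j : nat) : X -> X :=
  if j is j'.+1 then g j'.+1 \o orbit_map g j' else id.

Definition finite_open_cover (X : topologicalType) (U : set (set X)) : Prop :=
  [/\ finite_set U, U `<=` open & \bigcup_(A in U) A = [set: X]].

(* The empty string is allowed; it is irrelevant in the limit N --> \oo. *)
Definition strings (X : Type) (U : set (set X)) : set (seq (set X)) :=
  [set u | forall A, A \in u -> U A].

Definition string_set (X : Type) (g : nat -> X -> X) (u : seq (set X)) : set X :=
  [set x | forall j, (j < size u)%N -> nth set0 u j (orbit_map g j x)].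

Definition string_covers (X : Type) (g : nat -> X -> X) (K : set X)
    (U : set (set X)) (N : nat) : set (set (seq (set X))) :=
  [set G | [/\ countable G, G `<=` strings U,
     K `<=` \bigcup_(u in G) string_set g u &
     forall u, G u -> (N <= size u)%N]].

Definition string_weight (R : realType) (X : Type) (s alpha : R)
    (u : seq (set X)) : \bar R :=
  (expR (- (alpha * (size u)%:R `^ s)))%:E.

Definition pesin_M (R : realType) (X : Type) (g : nat -> X -> X) (K : set X)
    (s : R) (U : set (set X)) (alpha : R) (N : nat) : \bar R :=
  ereal_inf [set \esum_(u in G) string_weight s alpha u
            | G in string_covers g K U N].

Definition pesin_m (R : realType) (X : Type) (g : nat -> X -> X) (K : set X)
    (s : R) (U : set (set X)) (alpha : R) : \bar R :=
  limn (pesin_M g K s U alpha).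

(* The critical value is defined as an infimum; pesin_D_cover_sup below shows
   that it equals the corresponding supremum. *)
Definition pesin_D_cover (R : realType) (X : Type) (g : nat -> X -> X)
    (K : set X) (s : R) (U : set (set X)) : \bar R :=
  ereal_inf [set alpha%:E | alpha in [set alpha : R |
    pesin_m g K s U alpha = 0]].

Definition pesin_D (R : realType) (X : topologicalType) (g : nat -> X -> X)
    (K : set X) (s : R) : \bar R :=
  ereal_sup [set pesin_D_cover g K s U | U in @finite_open_cover X].

(* The infimum of the empty set is +oo.  See pesin_entropy_dim_sup for the
   expression as a supremum, where the supremum of the empty set is 0. *)
Definition pesin_entropy_dim (R : realType) (X : topologicalType)
    (g : nat -> X -> X) (K : set X) : \bar R :=
  ereal_inf [set s%:E | s in [set s : R | (0 < s)%R /\ pesin_D g K s = 0]].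

Lemma pesin_mE (R : realType) (X : Type) (g : nat -> X -> X) (K : set X)
    (s : R) (U : set (set X)) (alpha : R) :
  pesin_m g K s U alpha = ereal_sup (range (pesin_M g K s U alpha)).
Proof.
apply/cvg_lim => //; apply: ereal_nondecreasing_cvgn => N N' NN'.
apply: ereal_inf_le_tmp => _ [G [cG sG KG mG] <-]; exists G => //.
by split=> // u /mG; apply: leq_trans.
Qed.

Lemma pesin_M_ge0 (R : realType) (X : Type) (g : nat -> X -> X) (K : set X)
    (s : R) (U : set (set X)) (alpha : R) (N : nat) :
  0 <= pesin_M g K s U alpha N.
Proof.
apply/ereal_infP => _ [G _ <-]; apply: esum_ge0 => u _.
by rewrite lee_fin expR_ge0.
Qed.

Lemma pesin_m_ge0 (R : realType) (X : Type) (g : nat -> X -> X) (K : set X)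
    (s : R) (U : set (set X)) (alpha : R) : 0 <= pesin_m g K s U alpha.
Proof.
rewrite pesin_mE; apply: (le_trans (pesin_M_ge0 g K s U alpha 0)).
by apply: ereal_sup_ubound; exists 0%N.
Qed.

Lemma powR_nat_large (R : realType) (r A : R) : (0 < r)%R ->
  exists N : nat, forall n, (N <= n)%N -> (A <= n%:R `^ r)%R.
Proof.
move=> r0; have [N AN] : exists N : nat, (`|A| `^ r^-1 <= N%:R)%R.
  by exists (Num.truncn (`|A| `^ r^-1)).+1; apply/ltW/truncnS_gt.
exists N => n Nn; apply: le_trans (ler_norm A) _.
have -> : `|A|%R = ((`|A| `^ r^-1) `^ r)%R.
  by rewrite -powRrM mulVf ?lt0r_neq0// powRr1.
apply: ge0_ler_powR; rewrite ?nnegrE ?powR_ge0//; first exact: ltW.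
by apply: le_trans AN _; rewrite ler_nat.
Qed.

Lemma pesin_m_eq0 (R : realType) (X : Type) (g : nat -> X -> X) (K : set X)
    (U : set (set X)) (s t alpha beta : R) :
  (forall A : R, exists N : nat, forall n, (N <= n)%N ->
     (A <= beta * n%:R `^ t - alpha * n%:R `^ s)%R) ->
  pesin_m g K s U alpha != +oo -> pesin_m g K t U beta = 0.
Proof.
move=> large mfin.
have mfin' : pesin_m g K s U alpha \is a fin_num.
  by rewrite ge0_fin_numE ?pesin_m_ge0// ltey.
have le_m (c : R) : (0 < c)%R ->
    pesin_m g K t U beta <= c%:E * pesin_m g K s U alpha.
  move=> c0; have [N0 HN0] := large (- ln c)%R.
  rewrite [leLHS]pesin_mE; apply: ge_ereal_sup => _ [N _ <-].
  pose N1 := maxn N N0.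
  have M_le : pesin_M g K s U alpha N1 <= pesin_m g K s U alpha.
    by rewrite pesin_mE; apply: ereal_sup_ubound; exists N1.
  apply: le_trans (_ : _ <= c%:E * pesin_M g K s U alpha N1) _; last first.
    by rewrite lee_pmul2l.
  rewrite muleC -lee_pdivrMr //; apply/ereal_infP => _ [G [cG sG KG mG] <-].
  rewrite lee_pdivrMr // muleC.
  apply: le_trans (_ : _ <= \esum_(u in G) string_weight t beta u) _.
    apply: ereal_inf_lbound; exists G => //; split => // u /mG.
    by apply: leq_trans; rewrite leq_maxl.
  apply: ge_ereal_sup => _ [F [finF FG] <-].
  apply: le_trans (_ : _ <= \sum_(u \in F) (c%:E * string_weight s alpha u)) _.
    apply: lee_fsum => // u Fu; rewrite lee_fin -{1}(lnK c0) -expRD ler_expR.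
    have := HN0 (size u) (leq_trans (leq_maxr N N0) (mG _ (FG _ Fu))).
    by rewrite lerBrDr -lerBlDl => ?; lra.
  rewrite -ge0_mule_fsumr; last by move=> u; rewrite lee_fin expR_ge0.
  by rewrite lee_pmul2l //; apply: esum_ge; exists F.
apply/eqP; rewrite eq_le pesin_m_ge0 andbT.
move: mfin' le_m (pesin_m_ge0 g K s U alpha).
case: (pesin_m g K s U alpha) => // m _ le_m; rewrite lee_fin => m0.
apply/lee_addgt0Pr => e e0; rewrite add0e.
have m1 : (0 < m + 1)%R by lra.
apply: (le_trans (le_m (e / (m + 1))%R _)); first by rewrite divr_gt0.
by rewrite -EFinM lee_fin -mulrA ger_pMr// mulrC ler_pdivrMr//; lra.
Qed.

Lemma pesin_m_gt_eq0 (R : realType) (X : Type) (g : nat -> X -> X) (K : set X)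
    (U : set (set X)) (s alpha beta : R) : (0 < s)%R -> (alpha < beta)%R ->
  pesin_m g K s U alpha != +oo -> pesin_m g K s U beta = 0.
Proof.
move=> s0 ab; apply: pesin_m_eq0 => A.
have [N HN] := powR_nat_large (A / (beta - alpha)) s0.
exists N => n /HN; rewrite ler_pdivrMr ?subr_gt0// => /le_trans; apply.
by rewrite mulrBr ![(_ `^ _ * _)%R]mulrC.
Qed.

Lemma ereal_lt_reals (R : realType) (a b : \bar R) : a < b ->
  exists x y : R, [/\ a < x%:E, (x < y)%R & y%:E < b].
Proof.
case: a b => [a| |] [b| |] //; rewrite ?lte_fin => ab.
- by exists (a + (b - a) / 3)%R, (a + (b - a) / 3 * 2)%R;
    rewrite !lte_fin; split; lra.
- by exists (a + 1)%R, (a + 2)%R; rewrite !lte_fin ltry; split => //; lra.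
- by exists (b - 2)%R, (b - 1)%R; rewrite !lte_fin ltNyr; split => //; lra.
- by exists 0%R, 1%R; rewrite ltNyr ltry; split.
Qed.

Lemma pesin_D_cover_sup (R : realType) (X : Type) (g : nat -> X -> X)
    (K : set X) (s : R) (U : set (set X)) : (0 < s)%R ->
  pesin_D_cover g K s U =
  ereal_sup [set alpha%:E | alpha in [set alpha : R |
    pesin_m g K s U alpha = +oo]].
Proof.
move=> s0; apply/eqP; rewrite eq_le; apply/andP; split.
  rewrite leNgt; apply/negP => /ereal_lt_reals[a [b [Sa ab bI]]].
  have ma : pesin_m g K s U a != +oo.
    apply/eqP => ma; move: Sa; rewrite ltNge => /negP; apply.
    by apply: ereal_sup_ubound; exists a.
  move: bI; rewrite ltNge => /negP; apply; apply: ereal_inf_lbound.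
  by exists b => //; exact: pesin_m_gt_eq0 s0 ab ma.
apply: ge_ereal_sup => _ [a /= ma <-]; apply/ereal_infP => _ [b /= mb <-].
rewrite lee_fin leNgt; apply/negP => ba.
have mbfin : pesin_m g K s U b != +oo by rewrite mb.
by have := pesin_m_gt_eq0 s0 ba mbfin; rewrite ma.
Qed.

Lemma pesin_D_cover_ge0 (R : realType) (X : Type) (g : nat -> X -> X)
    (K : set X) (s : R) (U : set (set X)) :
  K !=set0 -> 0 <= pesin_D_cover g K s U.
Proof.
move=> [x Kx]; apply/ereal_infP => _ [a /= ma <-].
rewrite lee_fin leNgt; apply/negP => a0.
suff : 1 <= pesin_m g K s U a by rewrite ma lee_fin ler10.
rewrite pesin_mE; apply: le_ereal_sup_tmp; exists (pesin_M g K s U a 0).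
  by exists 0%N.
apply/ereal_infP => _ [G [_ _ KG _] <-].
have [u Gu _] := KG _ Kx.
apply: esum_ge; exists [set u]; first by split=> // _ ->.
rewrite fsbig_set1 lee_fin -expR0 ler_expR -mulNr.
by rewrite mulr_ge0 ?powR_ge0// oppr_ge0 ltW.
Qed.

Lemma pesin_D_ge0 (R : realType) (X : topologicalType) (g : nat -> X -> X)
    (K : set X) (s : R) : K !=set0 -> 0 <= pesin_D g K s.
Proof.
move=> K0; apply: le_ereal_sup_tmp.
exists (pesin_D_cover g K s [set setT]); last exact: pesin_D_cover_ge0.
exists [set setT] => //; split; first exact: finite_set1.
  by move=> _ ->; exact: openT.
by rewrite bigcup_set1.
Qed.

Lemma pesin_D_gt_eq0 (R : realType) (X : topologicalType) (g : nat -> X -> X)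
    (K : set X) (s t : R) : K !=set0 -> (0 < s)%R -> (s < t)%R ->
  pesin_D g K s != +oo -> pesin_D g K t = 0.
Proof.
move=> K0 s0 st Dfin; apply/eqP; rewrite eq_le pesin_D_ge0// andbT.
apply: ge_ereal_sup => _ [U coverU <-].
have : pesin_D_cover g K s U < +oo.
  by apply: le_lt_trans (_ : pesin_D g K s < _);
    [apply: ereal_sup_ubound; exists U | rewrite ltey].
move=> /ereal_inf_lt[_ [a /= ma <-] _].
apply/lee_addgt0Pr => e e0; rewrite add0e.
have afin : pesin_m g K s U a != +oo by rewrite ma.
have me : pesin_m g K t U e = 0.
  apply: pesin_m_eq0 afin => A.
  have st0 : (0 < t - s)%R by rewrite subr_gt0.
  have [N1 HN1] := powR_nat_large 1 s0.
  have [N2 HN2] := powR_nat_large ((`|A| + a) / e) st0.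
  exists (maxn 1 (maxn N1 N2)) => n.
  rewrite !geq_max => /and3P[n0 /HN1 ns /HN2].
  rewrite ler_pdivrMr// => nts.
  have -> : (n%:R `^ t = n%:R `^ (t - s) * n%:R `^ s :> R)%R.
    by rewrite -powRD ?subrK// pnatr_eq0 -lt0n n0 implybT.
  have := ler_norm A; have := normr_ge0 A.
  move: (n%:R `^ s)%R (n%:R `^ (t - s))%R `|A|%R ns nts => p q B; nra.
by apply: ereal_inf_lbound; exists e.
Qed.

Lemma pesin_entropy_dim_sup (R : realType) (X : topologicalType)
    (g : nat -> X -> X) (K : set X) : K !=set0 ->
  pesin_entropy_dim R g K =
  ereal_sup (0 |` [set s%:E | s in [set s : R |
    (0 < s)%R /\ pesin_D g K s = +oo]]).
Proof.
move=> K0; apply/eqP; rewrite eq_le; apply/andP; split.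
  rewrite leNgt; apply/negP => /ereal_lt_reals[a [b [Sa ab bI]]].
  have a0 : (0 < a)%R.
    rewrite -lte_fin; apply: le_lt_trans Sa.
    by apply: ereal_sup_ubound; left.
  have Da : pesin_D g K a != +oo.
    apply/eqP => Da; move: Sa; rewrite ltNge => /negP; apply.
    by apply: ereal_sup_ubound; right; exists a.
  move: bI; rewrite ltNge => /negP; apply; apply: ereal_inf_lbound.
  exists b => //; split; first exact: lt_trans ab.
  exact: pesin_D_gt_eq0 K0 a0 ab Da.
apply: ge_ereal_sup => _ [-> | [a /= [a0 Da] <-]];
  apply/ereal_infP => _ [b /= [b0 Db] <-].
  by rewrite lee_fin ltW.
rewrite lee_fin leNgt; apply/negP => ba.
have Dbfin : pesin_D g K b != +oo by rewrite Db.
by have := pesin_D_gt_eq0 K0 b0 ba Dbfin; rewrite Da.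
Qed.

(* Main.v *)
Require Import Defs.
From mathcomp Require Import all_boot all_order all_algebra.
From mathcomp Require Import finmap.
From mathcomp Require Import all_classical all_reals all_analysis.

(** It suffices to drop one map: if [g' = (g_2, g_3, ...)] is the tail of [g]
    and [g_1] maps [K] into itself, then [D(g, K) <= D(g', K)].

    Since [g_1^(j+1) = g'_1^j \o g_1], a point [x] of [K] follows the string
    [A :: u] under [g] as soon as [x] lies in [A] and [g_1 x], which is again
    in [K], follows [u] under [g'].  Hence a family of strings [G] covering [K]
    for [g'] yields the family of all [A :: u], with [A] in the finite cover [U]
    and [u] in [G], covering [K] for [g].  For [alpha >= 0] lengthening a string
    does not increase its weight, so the new family weighs at most [#|U|] times
    as much as [G] ([pesin_M_tail]).  The constant [#|U|] does not depend on the
    length of the strings, so the vanishing of the Pesin outer measure passes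
    from [g'] to [g] ([pesin_m_tail_eq0]); the restriction to [alpha >= 0] is
    harmless because the measure of a nonempty set does not vanish for negative
    [alpha].  Critical values, their supremum over the covers and the entropy
    dimension inherit the inequality. *)

Set Implicit Arguments.
Unset Strict Implicit.
Unset Printing Implicit Defensive.

Import Order.TTheory GRing.Theory Num.Theory.

Local Open Scope classical_set_scope.
Local Open Scope ring_scope.
Local Open Scope ereal_scope.

Lemma shifted_shifted2 (X : Type) (f : nat -> X -> X) (i : nat) :
  shifted (shifted f i) 2 = shifted f i.+1.
Proof. by apply: funext => k; rewrite /shifted /= addnS. Qed.

(** As indices start at 1, [shifted g 2] is the tail [(g_2, g_3, ...)]; what
    happens along an orbit after its first step is therefore governed by it. *)
Lemma orbit_map_tail (X : Type) (g : nat -> X -> X) (j : nat) (x : X) :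
  orbit_map g j.+1 x = orbit_map (shifted g 2) j (g 1%N x).
Proof. by elim: j => //= j <-. Qed.

Lemma string_set_cons (X : Type) (g : nat -> X -> X) (A : set X)
    (u : seq (set X)) (x : X) :
  A x -> string_set (shifted g 2) u (g 1%N x) -> string_set g (A :: u) x.
Proof. by move=> Ax ux [|j] //= /ux; rewrite -orbit_map_tail. Qed.

Definition prepend (X : Type) (U : set (set X)) (G : set (seq (set X))) :
    set (seq (set X)) :=
  [set p.1 :: p.2 | p in U `*` G].

Lemma prepend_covers (X : Type) (g : nat -> X -> X) (K : set X)
    (U : set (set X)) (N : nat) (G : set (seq (set X))) :
  finite_set U -> K `<=` \bigcup_(A in U) A -> K `<=` g 1%N @^-1` K ->
  string_covers (shifted g 2) K U N G -> string_covers g K U N (prepend U G).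
Proof.
move=> finU KU gK [cG sG KG mG]; split.
- apply: card_le_trans (card_image_le _ _) _.
  by apply: countableX => //; exact: finite_set_countable.
- move=> _ [[A u] [/= UA Gu] <-] B; rewrite inE => /orP[/eqP -> //|].
  exact: sG.
- move=> x Kx; have [A UA Ax] := KU _ Kx; have [u Gu ux] := KG _ (gK _ Kx).
  by exists (A :: u); [exists (A, u) | exact: string_set_cons].
- by move=> _ [[A u] [/= _ /mG Nu] <-] /=; exact: leqW.
Qed.

Lemma string_weight_cons (R : realType) (X : Type) (s alpha : R) (A : set X)
    (u : seq (set X)) : (0 < s)%R -> (0 <= alpha)%R ->
  string_weight s alpha (A :: u) <= string_weight s alpha u.
Proof.
move=> s0 a0; rewrite lee_fin ler_expR lerN2 ler_wpM2l//.
by apply: ge0_ler_powR; rewrite ?nnegrE ?ler0n ?ler_nat ?leqnSn// ltW.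
Qed.

(** Prepending is injective on pairs (symbol, string), so the sum splits into one
    sum over [G] for each of the [#|U|] possible first symbols. *)
Lemma esum_prepend (R : realType) (X : Type) (s alpha : R)
    (U : set (set X)) (G : set (seq (set X))) :
  (0 < s)%R -> (0 <= alpha)%R -> finite_set U ->
  \esum_(u in prepend U G) string_weight s alpha u <=
  #|` fset_set U|%:R%:E * \esum_(u in G) string_weight s alpha u.
Proof.
move=> s0 a0 finU.
have w0 u : 0 <= @string_weight R X s alpha u by rewrite lee_fin expR_ge0.
rewrite (reindex_esum (U `*` G) _ (fun p => p.1 :: p.2)); last first.
  split; first by move=> p UGp; exists p.
    by move=> [A u] [B v] _ _ /= [-> ->].
  by move=> _ [p UGp <-]; exists p.
rewrite -(@esum_esum _ _ _ U (fun=> G)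
  (fun A u => string_weight s alpha (A :: u))); last by [].
rewrite esum_fset//; last by move=> A _; exact: esum_ge0.
apply: le_trans
    (_ : _ <= \sum_(A \in U) \esum_(u in G) string_weight s alpha u) _.
  apply: (lee_fsum finU) => A _.
  apply: le_esum => u _.
  exact: (string_weight_cons A u s0 a0).
by rewrite fsbig_finite//= big_const_seq count_predT mule_natl /enatmul Monoid.iteropE.
Qed.

Lemma pesin_M_tail (R : realType) (X : Type) (g : nat -> X -> X) (K : set X)
    (s : R) (U : set (set X)) (alpha : R) (N : nat) :
  (0 < s)%R -> (0 <= alpha)%R -> finite_set U ->
  K !=set0 -> K `<=` \bigcup_(A in U) A -> K `<=` g 1%N @^-1` K ->
  pesin_M g K s U alpha N <=
  #|` fset_set U|%:R%:E * pesin_M (shifted g 2) K s U alpha N.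
Proof.
move=> s0 a0 finU [x Kx] KU gK.
(* Dividing by #|U| needs a nonempty cover, and the point x of K provides it. *)
have U0 : (0 < #|` fset_set U|%:R :> R)%R.
  have [A UA _] := KU _ Kx.
  rewrite ltr0n cardfs_gt0; apply/fset0Pn; exists A.
  by rewrite in_fset_set// inE.
rewrite muleC -lee_pdivrMr//; apply/ereal_infP => _ [G coverG <-].
rewrite lee_pdivrMr// muleC; apply: le_trans (esum_prepend _ s0 a0 finU).
by apply: ereal_inf_lbound; exists (prepend U G) => //; exact: prepend_covers.
Qed.

Lemma pesin_m_eq0_ge0 (R : realType) (X : Type) (g : nat -> X -> X)
    (K : set X) (s : R) (U : set (set X)) (alpha : R) :
  K !=set0 -> pesin_m g K s U alpha = 0 -> (0 <= alpha)%R.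
Proof.
move=> K0 m0; rewrite -lee_fin.
apply: le_trans (pesin_D_cover_ge0 g s U K0) _.
by apply: ereal_inf_lbound; exists alpha.
Qed.

Lemma pesin_m_tail_eq0 (R : realType) (X : Type) (g : nat -> X -> X)
    (K : set X) (s : R) (U : set (set X)) (alpha : R) :
  (0 < s)%R -> finite_set U ->
  K !=set0 -> K `<=` \bigcup_(A in U) A -> K `<=` g 1%N @^-1` K ->
  pesin_m (shifted g 2) K s U alpha = 0 -> pesin_m g K s U alpha = 0.
Proof.
move=> s0 finU K0 KU gK m0; have a0 := pesin_m_eq0_ge0 K0 m0.
apply/eqP; rewrite eq_le pesin_m_ge0 andbT pesin_mE.
apply: ge_ereal_sup => _ [N _ <-].
apply: le_trans (pesin_M_tail _ s0 a0 finU K0 KU gK) _.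
(* The outer measure is the supremum over N, so it vanishes at each stage. *)
suff -> : pesin_M (shifted g 2) K s U alpha N = 0 by rewrite mule0.
apply/eqP; rewrite eq_le pesin_M_ge0 andbT -m0 pesin_mE.
by apply: ereal_sup_ubound; exists N.
Qed.

Lemma pesin_D_tail (R : realType) (X : topologicalType) (g : nat -> X -> X)
    (K : set X) (s : R) : (0 < s)%R -> K !=set0 -> K `<=` g 1%N @^-1` K ->
  pesin_D g K s <= pesin_D (shifted g 2) K s.
Proof.
move=> s0 K0 gK; apply: ge_ereal_sup => _ [U coverU <-].
apply: le_trans (_ : _ <= pesin_D_cover (shifted g 2) K s U) _; last first.
  by apply: ereal_sup_ubound; exists U.
case: coverU => finU _ UT.
apply: ereal_inf_le_tmp => _ [alpha /= m0 <-]; exists alpha => //=.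
by apply: pesin_m_tail_eq0 m0 => //; rewrite UT.
Qed.

Lemma pesin_entropy_dim_tail (R : realType) (X : topologicalType)
    (g : nat -> X -> X) (K : set X) : K !=set0 -> K `<=` g 1%N @^-1` K ->
  pesin_entropy_dim R g K <= pesin_entropy_dim R (shifted g 2) K.
Proof.
move=> K0 gK; apply: ereal_inf_le_tmp => _ [s /= [s0 D0] <-]; exists s => //=.
split=> //; apply/eqP; rewrite eq_le pesin_D_ge0// andbT -D0.
exact: pesin_D_tail.
Qed.

Theorem theorem3p15 (R : realType) (X : topologicalType) (f : nat -> X -> X)
    (K : set X) (i j : nat) :
  nds f -> (K !=set0)%classic -> nds_invariant f K ->
  (1 <= i)%N -> (i <= j)%N ->
  (pesin_entropy_dim R (shifted f i) K <= pesin_entropy_dim R (shifted f j) K)%E.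
Proof.
move=> _ K0 invK i1; elim: j => [|j IHj]; first by rewrite leqNgt i1.
rewrite leq_eqVlt => /predU1P[-> // | ij].
apply: le_trans (IHj ij) _; rewrite -shifted_shifted2.
apply: pesin_entropy_dim_tail => //.
by rewrite /shifted addn1 /= invK// (leq_trans i1).
Qed.
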